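(* Consider the two-type crowdsourcing model with $n$ workers and $m$ items, with $n_1=\lceil n/2\rceil$, $n_2=n-n_1$, $m_2=\lceil m^{1/2}\rceil$, $m_1=m-m_2$. Let $\hat y$ be the majority voting estimator. If $n$ and $m$ are sufficiently large and $\frac{n\log m}{m}$ is sufficiently small (that is, there exist $N$ and $\varepsilon>0$ such that the following holds whenever $n,m\ge N$ and $\frac{n\log m}{m}\le\varepsilon$), then for any $y^*\in\{0,1\}^m$, $$\frac1m\sum_{j\in[m]}|\hat y_j-y_j^*|\le\exp\left(-\frac1{25}n\right)$$ with probability at least $1-e^{-n/200}$.
   Context: $[k]=\{1,\dots,k\}$. Two-type model: the item set $[m]$ is partitioned into $S_1$ (Type I) and $S_2$ (Type II) with $|S_1|=m_1$, $|S_2|=m_2$; the worker set $[n]$ is partitioned into $G_1,G_2$ with $|G_1|=n_1$, $|G_2|=n_2$. The $T_{ij}$ ($i\in[n]$, $j\in[m]$) are independent Bernoulli variables (indicating that worker $i$ labels item $j$ correctly) with $\mathbb P(T_{ij}=1)=\frac45$ if $(i,j)\in(G_1\times S_1)\cup(G_2\times S_2)$ and $\mathbb P(T_{ij}=1)=\frac12$ if $(i,j)\in(G_1\times S_2)\cup(G_2\times S_1)$. Given the fixed true labels $y^*\in\{0,1\}^m$, the observed data are $X_{ij}=T_{ij}y_j^*+(1-T_{ij})(1-y_j^* )$. The majority voting estimator is $\hat y_j=\mathbb I\{\sum_{i\in[n]}X_{ij}\ge n/2\}$ for $j\in[m]$. *)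

(* Defs.v *)
From HB Require Import structures.
From mathcomp Require Import all_boot all_order all_algebra.
From mathcomp Require Import all_classical all_reals all_analysis.

Set Implicit Arguments.
Unset Strict Implicit.
Unset Printing Implicit Defensive.

Import Order.TTheory GRing.Theory Num.Theory.

Local Open Scope classical_set_scope.
Local Open Scope ring_scope.

(* Mutual independence: the product rule is required for every subfamily [J]
   of the (finite) index set, not only for the whole family. *)
Definition mutually_independent d d' (Omega : measurableType d)
    (E : measurableType d') (R : realType) (P : probability Omega R)
    (I : finType) (X : I -> {RV P >-> E}) : Prop :=
  forall (J : {set I}) (A : I -> set E),
    (forall i, i \in J -> measurable (A i)) ->
    P [set w | forall i, i \in J -> A i (X i w)] =
      (\prod_(i in J) P [set w | A i (X i w)])%E.

(* [T i j w] is the indicator that worker [i] labels item [j] correctly.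
   [G1], [G2] are the two classes of workers and [S1], [S2] the two types of
   items; classes are allowed to be empty. *)
Record two_type_model d (Omega : measurableType d) (R : realType)
    (P : probability Omega R) (n m n1 n2 m1 m2 : nat)
    (G1 G2 : {set 'I_n}) (S1 S2 : {set 'I_m})
    (T : 'I_n -> 'I_m -> {RV P >-> bool}) : Prop := TwoTypeModel {
  workers_partition : G2 = (~: G1)%SET;
  card_G1 : #|G1| = n1;
  card_G2 : #|G2| = n2;
  items_partition : S2 = (~: S1)%SET;
  card_S1 : #|S1| = m1;
  card_S2 : #|S2| = m2;
  labels_independent :
    mutually_independent (fun ij : 'I_n * 'I_m => T ij.1 ij.2);
  prob_same_type : forall i j,
    ((i \in G1) && (j \in S1)) || ((i \in G2) && (j \in S2)) ->
    P [set w | T i j w = true] = (4 / 5)%:E;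
  prob_other_type : forall i j,
    ((i \in G1) && (j \in S2)) || ((i \in G2) && (j \in S1)) ->
    P [set w | T i j w = true] = (1 / 2)%:E
}.

Definition observed (R : realType) (n m : nat) (t : 'I_n -> 'I_m -> bool)
    (y : {ffun 'I_m -> bool}) (i : 'I_n) (j : 'I_m) : R :=
  (t i j)%:R * (y j)%:R + (1 - (t i j)%:R) * (1 - (y j)%:R).

(* Ties are resolved in favour of label 1. *)
Definition majority_vote (R : realType) (n m : nat) (X : 'I_n -> 'I_m -> R) :
    {ffun 'I_m -> bool} :=
  [ffun j => n%:R / 2 <= \sum_(i < n) X i j].

Definition error_rate (R : realType) (m : nat)
    (yhat y : {ffun 'I_m -> bool}) : R :=
  m%:R^-1 * \sum_(j < m) `|(yhat j)%:R - (y j)%:R|.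

(* Main.v *)
(* An item is mislabelled only if at most half of the [n] workers are correct on
   it.  Bounding the indicator of this event by [2 ^ (n/2 - N)], with [N] the
   number of correct workers, each [4/5]-worker contributes a factor [3/5] and
   each [1/2]-worker a factor [3/4].  Up to rounding there are [n/2] workers of
   each kind whatever the type of the item, so every item is mislabelled with
   probability at most [(2 * 3/5 * 3/4) ^ (n/2) = (9/10) ^ (n/2)], which is
   smaller than [exp (- n/25) * exp (- n/200)] for [n >= 10].  Markov's inequality applied to
   the number of mislabelled items concludes. *)
Require Import Defs.
From HB Require Import structures.
From mathcomp Require Import all_boot all_order all_algebra.
From mathcomp Require Import all_classical all_reals all_analysis.
From mathcomp Require Import measurable_realfun zify ring lra.

Set Implicit Arguments.
Unset Strict Implicit.
Unset Printing Implicit Defensive.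

Import Order.TTheory GRing.Theory Num.Theory.

Local Open Scope classical_set_scope.
Local Open Scope ring_scope.

(** * Independence of re-indexed subfamilies *)

Lemma mutually_independent_inj d d' (Omega : measurableType d)
    (E : measurableType d') (R : realType) (P : probability Omega R)
    (I I' : finType) (f : I' -> I) (X : I -> {RV P >-> E}) :
  injective f -> mutually_independent X ->
  mutually_independent (fun i => X (f i)).
Proof.
move=> f_inj indX J A mA.
(* [A'] carries [A] along [f]; the default [setT] is never consulted, since only indices in [f @: J]
   occur below. *)
pose A' i := if [pick k | f k == i] is Some k then A k else setT.
have A'f k : A' (f k) = A k.
  rewrite /A'; case: pickP => [k' /eqP /f_inj -> //|/(_ k)].
  by rewrite eqxx.
have mA' i : i \in f @: J -> measurable (A' i).
  by move=> /imsetP[k kJ ->]; rewrite A'f; exact: mA.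
transitivity (P [set w | forall i, i \in f @: J -> A' i (X i w)]).
  congr (P _); apply/seteqP; split=> w /= Aw.
    by move=> _ /imsetP[k kJ ->]; rewrite A'f; exact: Aw.
  by move=> k kJ; rewrite -A'f; apply: Aw; exact: imset_f.
rewrite (indX _ _ mA') big_imset /=; last by move=> ? ? _ _ /f_inj.
by apply: eq_bigr => k kJ; rewrite A'f.
Qed.

(** * Finite boolean families and a Chernoff bound *)

Section boolean_family.
Context d (Omega : measurableType d) (R : realType) (P : probability Omega R).
Context (I : finType) (X : I -> {RV P >-> bool}).

(** The joint outcome encoded as a finite set: any event about the family is a finite disjoint union
    of atoms [trues w = K]. *)
Let trues (w : Omega) : {set I} := [set i | X i w]%SET.

Lemma measurable_eq_bool_rv (i : I) (b : bool) :
  measurable [set w | X i w = b].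
Proof.
rewrite -[X in measurable X]setTI.
exact: (@measurable_funPT _ _ _ _ (X i) measurableT [set b]).
Qed.

Lemma trues_eqE (K : {set I}) :
  [set w | trues w = K] = \bigcap_(i in [set: I]) [set w | X i w = (i \in K)].
Proof.
apply/seteqP; split=> w /=.
  by move=> <- i _ /=; rewrite inE.
by move=> H; apply/setP => i; rewrite inE; exact: H.
Qed.

Lemma measurable_trues_eq (K : {set I}) : measurable [set w | trues w = K].
Proof.
rewrite trues_eqE; apply: fin_bigcap_measurable => // i _.
exact: measurable_eq_bool_rv.
Qed.

Lemma pred_truesE (Q : pred {set I}) :
  [set w | Q (trues w)] = \bigcup_(K in [set` Q]) [set w | trues w = K].
Proof.
apply/seteqP; split=> w /=; first by move=> Qw; exists (trues w).
by case=> K /= QK ->.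
Qed.

Lemma measurable_pred_trues (Q : pred {set I}) :
  measurable [set w | Q (trues w)].
Proof.
rewrite pred_truesE; apply: fin_bigcup_measurable => // K _.
exact: measurable_trues_eq.
Qed.

Lemma prob_pred_trues (Q : pred {set I}) :
  P [set w | Q (trues w)] = (\sum_(K | Q K) P [set w | trues w = K])%E.
Proof.
rewrite pred_truesE measure_fin_bigcup//.
- by rewrite [RHS]bigfs ?index_enum_uniq // => K _; rewrite mem_index_enum.
- by move=> K L _ _ [w [/= <- <-]].
- by move=> K _; exact: measurable_trues_eq.
Qed.

Context (p : I -> R).
Hypothesis Xindep : mutually_independent X.
Hypothesis Xp : forall i, P [set w | X i w = true] = (p i)%:E.

Lemma success_prob_itv (i : I) : 0 <= p i <= 1.
Proof.
rewrite -!lee_fin -Xp measure_ge0/= probability_le1 //.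
exact: measurable_eq_bool_rv.
Qed.

Lemma prob_eq_bool_rv (i : I) (b : bool) :
  P [set w | X i w = b] = (if b then p i else 1 - p i)%:E.
Proof.
case: b; first exact: Xp.
have -> : [set w | X i w = false] = ~` [set w | X i w = true].
  by apply/seteqP; split=> w /=; case: (X i w).
by rewrite probability_setC ?Xp //; exact: measurable_eq_bool_rv.
Qed.

Lemma prob_trues_eq (K : {set I}) :
  P [set w | trues w = K] = (\prod_i (if i \in K then p i else 1 - p i))%:E.
Proof.
rewrite -prodEFin; under eq_bigr do rewrite -prob_eq_bool_rv.
(* [A i] is the singleton of the boolean [i \in K], so the full intersection is the atom of [K]. *)
have := Xindep (J := finset.setT) (A := fun i => [set i \in K]).
rewrite big_mkcond/=; under eq_bigr do rewrite inE.
move=> <- //; congr (P _); apply/seteqP; split=> w /=.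
  by move=> <- i _; rewrite inE.
by move=> H; apply/setP => i; rewrite inE; apply: H; rewrite inE.
Qed.

(* Chernoff bound at the parameter making the moment generating function
   [E (1/2) ^ (number of successes)]. *)
Lemma chernoff_half (h : nat) (Q : pred {set I}) :
  (forall K : {set I}, Q K -> (#|K| <= h)%N) ->
  (P [set w | Q (trues w)] <= (2 ^+ h * \prod_i (1 - p i / 2))%:E)%E.
Proof.
move=> Qh; rewrite prob_pred_trues.
rewrite (eq_bigr _ (fun K _ => prob_trues_eq K)).
rewrite sumEFin lee_fin.
(* Splitting each factor into success and failure lets the product expand into a sum over all sets
   [K], to be compared term by term with the atoms. *)
under [in leRHS]eq_bigr => i _.
  rewrite (_ : 1 - p i / 2 = p i / 2 + (1 - p i)); last by field.
  over.
rewrite bigA_distr mulr_sumr big_mkcond /=; apply: ler_sum => K _.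
have w_ge0 i : 0 <= if i \in K then p i else 1 - p i.
  by have := success_prob_itv i; case: ifP => _ /andP[]; lra.
have -> : \prod_i (if i \in K then p i / 2 else 1 - p i) =
    2 ^- #|K| * \prod_i (if i \in K then p i else 1 - p i).
  rewrite -exprVn -prodr_const [X in X * _]big_mkcond -big_split /=.
  by apply: eq_bigr => i _; case: ifP => _; rewrite ?mul1r // mulrC.
have W_ge0 : 0 <= \prod_i (if i \in K then p i else 1 - p i).
  by apply: prodr_ge0 => i _.
(* If [Q K] holds, the extra factor [2 ^+ h / 2 ^+ #|K|] is at least 1; otherwise the left term is
   0. *)
rewrite mulrA; case: ifP => QK.
  rewrite ler_peMl // ler_pdivlMr ?exprn_gt0 // mul1r.
  by rewrite ler_eXn2l ?ltr1n // Qh.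
by rewrite !mulr_ge0 ?exprn_ge0 ?invr_ge0 ?exprn_ge0.
Qed.

End boolean_family.

(** * Markov's inequality for a count of events *)

Lemma markov_count d (Omega : measurableType d) (R : realType)
    (P : probability Omega R) (I : finType) (E : I -> set Omega) (c : R) :
  (forall i, measurable (E i)) -> 0 < c ->
  (c%:E * P [set w | (c <= \sum_i (\1_(E i) w : R))%R] <= \sum_i P (E i))%E.
Proof.
move=> mE c0.
have m1 i : measurable_fun [set: Omega] (\1_(E i) : Omega -> R).
  exact: measurable_indic.
have mg : measurable_fun [set: Omega]
    (fun w => (\sum_i (\1_(E i) w : R))%:E).
  by apply/measurable_EFinP; exact: measurable_sum.
have g0 w : (0 <= \sum_i (\1_(E i) w : R)).
  by apply: sumr_ge0 => i _; rewrite indicE.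
have := le_integral_abse P measurableT mg c0.
rewrite setTI; congr (_ * P _ <= _)%E.
  by apply/seteqP; split=> w /=; rewrite lee_fin ger0_norm.
under eq_integral => w _.
  rewrite gee0_abs ?lee_fin // -sumEFin; over.
rewrite ge0_integral_sum //=; last by move=> i; apply/measurable_EFinP.
by apply: eq_bigr => i _; rewrite integral_indic // setIT.
Qed.

(** * Error probability of a single item *)

Lemma sum_observed (R : realType) (n m : nat) (t : 'I_n -> 'I_m -> bool)
    (y : {ffun 'I_m -> bool}) (j : 'I_m) :
  \sum_i observed R t y i j =
    (if y j then #|[set i | t i j]%SET| else n - #|[set i | t i j]%SET|)%N%:R.
Proof.
have sumt : \sum_i (t i j)%:R = #|[set i | t i j]%SET|%:R :> R.
  rewrite -sum1_card natr_sum [RHS]big_mkcond.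
  by apply: eq_bigr => i _; rewrite inE; case: (t i j).
have := max_card (mem [set i | t i j]%SET); rewrite card_ord => le_n.
rewrite /observed; case: (y j).
  by under eq_bigr do rewrite mulr1 subrr mulr0 addr0.
under eq_bigr do rewrite mulr0 add0r subr0 mulr1.
by rewrite sumrB sumt sumr_const card_ord natrB.
Qed.

(** With [k] correct workers, an error means [2k < n] for label 1 and [2k <= n] for label 0, where a
    tie is also an error. *)
Lemma majority_vote_error_card (R : realType) (n k : nat) (b : bool) :
  (k <= n)%N ->
  ((n%:R / 2 <= (if b then k else n - k)%N%:R :> R) != b) -> (k <= n./2)%N.
Proof.
move=> kn; rewrite ler_pdivrMr // -natrM ler_nat.
by case: b; lia.
Qed.

Lemma ceil_half_bounds (R : realType) (n n1 : nat) :
  n1%:Z = Num.ceil (n%:R / 2 : R) -> (n./2 <= n1)%N /\ (n./2 <= n - n1)%N.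
Proof.
move=> n1E.
have : (n1%:Z <= (uphalf n)%:Z)%R.
  rewrite n1E ceil_le_int ler_pdivrMr // -pmulrn -natrM ler_nat; lia.
have : (n%:R / 2 <= n1%:Z%:~R :> R) by rewrite -ceil_le_int n1E.
rewrite ler_pdivrMr // -pmulrn -natrM ler_nat; lia.
Qed.

(** As 9/10 is at most [exp (-1/10)] and [n./2 >= (n-1)/2], it suffices that
    [(n-1)/20 >= n/25 + n/200 = 9n/200], that is, [n >= 10]. *)
Lemma ninetenths_pow_half_le (R : realType) (n : nat) : (10 <= n)%N ->
  (9 / 10 : R) ^+ n./2 <= expR (- (1 / 25 * n%:R)) * expR (- (n%:R / 200)).
Proof.
move=> n10.
have base : 9 / 10 <= expR (- (1 / 10)) :> R.
  by apply: le_trans (expR_ge1Dx _); lra.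
apply: (le_trans (lerXn2r n./2 _ _ base)); rewrite ?nnegrE ?expR_ge0 //.
rewrite -expRM_natr -expRD ler_expR.
have : n%:R <= (2 * n./2 + 1)%:R :> R by rewrite ler_nat; lia.
have : 10 <= n%:R :> R by rewrite ler_nat.
rewrite natrD natrM; lra.
Qed.

(** Here [G] is the class of workers matching the type of the item and [b] is its true label, so
    that one bound serves both types and both labels. *)
Lemma error_prob_le (R : realType) (n : nat) d (Omega : measurableType d)
    (P : probability Omega R) (G : {set 'I_n}) (X : 'I_n -> {RV P >-> bool})
    (b : bool) :
  (n./2 <= #|G|)%N -> (n./2 <= #|~: G|)%N ->
  mutually_independent X ->
  (forall i, P [set w | X i w = true] = (if i \in G then 4 / 5 else 1 / 2)%:E) ->
  (P [set w | ((n%:R / 2 <= (if b then #|[set i | X i w]%SET|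
      else n - #|[set i | X i w]%SET|)%N%:R :> R) != b)%R] <=
    ((9 / 10) ^+ n./2)%:E)%E.
Proof.
move=> hG hGC Xindep Xp.
apply: le_trans (chernoff_half (h := n./2)
  (Q := fun K : {set 'I_n} =>
    (n%:R / 2 <= (if b then #|K| else n - #|K|)%N%:R :> R) != b)
  Xindep Xp _) _.
  move=> K; apply: majority_vote_error_card.
  by rewrite -[n in (_ <= n)%N]card_ord max_card.
rewrite lee_fin (bigID (mem G)) /=.
rewrite (eq_bigr (fun=> 3 / 5)) => [|i ->]; last by field.
rewrite [X in _ * (_ * X)](eq_bigr (fun=> 3 / 4)) => [|i /negbTE ->]; last by field.
rewrite prodr_const.
have -> : \prod_(i | i \notin G) (3 / 4 : R) = (3 / 4) ^+ #|~: G|.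
  by rewrite -prodr_const; apply: eq_bigl => i; rewrite inE.
have -> : 9 / 10 = 2 * (3 / 5 * (3 / 4)) :> R by field.
rewrite [leRHS]exprMn [X in _ <= _ * X]exprMn ler_pM2l ?exprn_gt0 //.
(* Both bases are below 1, so lowering the exponents [#|G|] and [#|~: G|] to [n./2] only increases
   the powers. *)
by apply: ler_pM; rewrite ?exprn_ge0 ?ler_wiXn2l //; lra.
Qed.

(** * From single items to the error rate *)

Lemma error_rate_indic (R : realType) (m : nat) (Omega : Type)
    (yhat : Omega -> {ffun 'I_m -> bool}) (y : {ffun 'I_m -> bool}) (w : Omega) :
  error_rate R (yhat w) y =
  m%:R^-1 * \sum_j \1_[set w | yhat w j != y j] w.
Proof.
congr (_ * _); apply: eq_bigr => j _; rewrite indicE.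
have -> : (w \in [set w | yhat w j != y j]) = (yhat w j != y j).
  by apply/idP/idP; rewrite inE.
by case: (yhat w j) (y j) => -[];
  rewrite /= ?subrr ?normr0 ?subr0 ?sub0r ?normrN ?normr1.
Qed.

(** The expected number of errors is at most [m * q], so by Markov it exceeds [m * c] with
    probability at most [q / c], hence at most [delta]. *)
Lemma prob_error_rate_le d (Omega : measurableType d) (R : realType)
    (P : probability Omega R) (m : nat) (yhat : Omega -> {ffun 'I_m -> bool})
    (y : {ffun 'I_m -> bool}) (q c delta : R) :
  (0 < m)%N -> 0 < c ->
  (forall j, measurable [set w | yhat w j != y j]) ->
  (forall j, (P [set w | yhat w j != y j] <= q%:E)%E) -> q <= c * delta ->
  ((1 - delta)%:E <= P [set w | (error_rate R (yhat w) y <= c)%R])%E.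
Proof.
move=> m0 c0 mE Eq qcd.
have mR0 : 0 < m%:R :> R by rewrite ltr0n.
pose S w : R := \sum_j \1_[set w | yhat w j != y j] w.
have mS : measurable_fun [set: Omega] S.
  by apply: measurable_sum => j; exact: measurable_indic.
have -> : [set w | error_rate R (yhat w) y <= c] = ~` [set w | m%:R * c < S w].
  apply/seteqP; split=> w /=; rewrite error_rate_indic ler_pdivrMl // leNgt.
    by move=> /negP.
  by move=> /negP.
have mlt : measurable [set w | m%:R * c < S w].
  rewrite -[X in measurable X]setTI (_ : [set w | _] = S @^-1` `]m%:R * c, +oo[).
    by apply: mS.
  by apply/seteqP; split=> w /=; rewrite in_itv /= andbT.
have mle : measurable [set w | m%:R * c <= S w].
  rewrite -[X in measurable X]setTI (_ : [set w | _] = S @^-1` `[m%:R * c, +oo[).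
    by apply: mS.
  by apply/seteqP; split=> w /=; rewrite in_itv /= andbT.
rewrite probability_setC // EFinB leeB //.
(* The complement is a strict inequality, while [markov_count] bounds the larger non-strict
   event. *)
apply: (@le_trans _ _ (P [set w | m%:R * c <= S w])).
  by apply: le_measure; rewrite ?inE // => w /=; exact: ltW.
have mc0 : 0 < m%:R * c by rewrite mulr_gt0.
rewrite -(@lee_pmul2l _ (m%:R * c)%:E) ?lte_fin //.
apply: le_trans (markov_count P mE mc0) _.
apply: (@le_trans _ _ (\sum_(j < m) q%:E)%E); first exact: lee_sum.
by rewrite sumEFin -EFinM lee_fin sumr_const card_ord -[leLHS]mulr_natl -mulrA ler_pM2l.
Qed.

Theorem theorem4p3 (R : realType) :
  exists (N : nat) (eps : R), 0 < eps /\
  forall (n m n1 n2 m1 m2 : nat),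
    (N <= n)%N -> (N <= m)%N ->
    n%:R * ln m%:R / m%:R <= eps ->
    n1%:Z = Num.ceil (n%:R / 2 : R) ->
    n2 = (n - n1)%N ->
    m2%:Z = Num.ceil (Num.sqrt m%:R : R) ->
    m1 = (m - m2)%N ->
  forall (d : measure_display) (Omega : measurableType d)
    (P : probability Omega R)
    (G1 G2 : {set 'I_n}) (S1 S2 : {set 'I_m})
    (T : 'I_n -> 'I_m -> {RV P >-> bool}),
    two_type_model n1 n2 m1 m2 G1 G2 S1 S2 T ->
  forall y : {ffun 'I_m -> bool},
    ((1 - expR (- (n%:R / 200)))%R%:E <=
     P [set w | (error_rate R
                   (majority_vote (observed R (fun i j => T i j w) y)) y
                 <= expR (- (1 / 25 * n%:R)))%R])%E.
Proof.
(* The value 10 is the threshold in [ninetenths_pow_half_le]; for [m] it also ensures positivity. *)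
exists 10, 1; split=> // n m n1 n2 m1 m2 n10 m10 _ n1E n2E _ _ d Omega P G1 G2 S1 S2 T.
case=> G2E cG1 cG2 S2E _ _ indep same other y.
have [hG1 hG2] := ceil_half_bounds n1E.
rewrite -n2E -cG2 in hG2; rewrite -cG1 in hG1.
have errE j : [set w | majority_vote (observed R (fun i j => T i j w) y) j != y j] =
    [set w | (n%:R / 2 <= (if y j then #|[set i | T i j w]%SET|
      else n - #|[set i | T i j w]%SET|)%N%:R :> R) != y j].
  by apply/seteqP; split=> w /=; rewrite ffunE sum_observed.
(* Unification with the goal sets [c] to [exp (-n/25)] and [delta] to [exp (-n/200)]. *)
apply: (prob_error_rate_le (q := (9 / 10) ^+ n./2)); rewrite ?expR_gt0 //.
- exact: leq_trans m10.
- move=> j; rewrite errE.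
  exact: (measurable_pred_trues (fun i => T i j)
    (fun K => (n%:R / 2 <=
      (if y j then #|K| else n - #|K|)%N%:R :> R) != y j)).
- move=> j; rewrite errE.
  have indj : mutually_independent (fun i => T i j).
    by apply: (mutually_independent_inj (f := fun i => (i, j)) _ indep)
      => i i' [].
  (* The class with success probability 4/5 is [G1] on Type I items and [G2] on Type II items. *)
  have [jS1|jS1] := boolP (j \in S1).
    apply: (@error_prob_le _ _ _ _ _ G1) => //; first by rewrite -G2E.
    move=> i; case: ifPn => iG1.
      by apply: same; rewrite iG1 jS1.
    by apply: other; rewrite G2E inE iG1 jS1 orbT.
  apply: (@error_prob_le _ _ _ _ _ G2) => //; first by rewrite G2E finset.setCK.
  move=> i; case: ifPn => iG2.
    by apply: same; rewrite iG2 S2E inE jS1 orbT.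
  by apply: other; rewrite S2E inE jS1; move: iG2; rewrite G2E inE negbK => ->.
- exact: ninetenths_pow_half_le.
Qed.
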